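(* Let $R$ be a ring, $\delta$ a derivation of $R$, and $S=R[x;\delta]$ the differential polynomial ring. Put $J_0=J(S)\cap R$, where $J(S)$ is the Jacobson radical of $S$. The following five assertions are equivalent: (i) $S$ is left quasi-duo; (ii) $S$ is right quasi-duo; (iii) every left ideal of $S$ containing $J(S)$ is two-sided, i.e. $S/J(S)$ is left duo; (iv) every right ideal of $S$ containing $J(S)$ is two-sided, i.e. $S/J(S)$ is right duo; (v) the quotient ring $R/J_0$ is commutative and $\delta(R)\subseteq J_0$.
   Context: All rings are unital and associative. A derivation of $R$ is an additive map $\delta:R\to R$ with $\delta(rs)=r\delta(s)+\delta(r)s$. The differential polynomial ring $R[x;\delta]$ is, as a left $R$-module, the polynomial ring $R[x]$, with multiplication determined by $xr=rx+\delta(r)$ for $r\in R$. A ring is left (right) duo if every left (right) ideal is two-sided, and left (right) quasi-duo if every maximal left (right) ideal is two-sided. *)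

(* Defs.v *)
From HB Require Import structures.
From mathcomp Require Import all_boot all_order all_algebra.
Set Implicit Arguments. Unset Strict Implicit. Unset Printing Implicit Defensive.
Import GRing.Theory.
Local Open Scope ring_scope.

Definition is_derivation (R : nzRingType) (d : {additive R -> R}) : Prop :=
  forall r s : R, d (r * s) = r * d s + d r * s.

(* S (with the subring embedding iota : R -> S and the element x) is the
   differential polynomial ring R[x; d]: as a left R-module it is R[x], i.e.
   p |-> sum_i p_i x^i is a bijection {poly R} -> S, and x r = r x + d(r). *)
Definition is_diff_poly_ring (R : nzRingType) (d : R -> R) (S : nzRingType)
    (iota : {rmorphism R -> S}) (x : S) : Prop :=
  (forall r : R, x * iota r = iota r * x + iota (d r)) /\
  bijective (fun p : {poly R} => \sum_(i < size p) iota p`_i * x ^+ i).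

Section Ideals.
Variable S : nzRingType.

Definition left_ideal (I : S -> Prop) : Prop :=
  I 0 /\ (forall a b, I a -> I b -> I (a - b)) /\ (forall r a, I a -> I (r * a)).

Definition right_ideal (I : S -> Prop) : Prop :=
  I 0 /\ (forall a b, I a -> I b -> I (a - b)) /\ (forall r a, I a -> I (a * r)).

Definition two_sided_ideal (I : S -> Prop) : Prop := left_ideal I /\ right_ideal I.

Definition maximal_left_ideal (I : S -> Prop) : Prop :=
  left_ideal I /\ ~ I 1 /\
  (forall K : S -> Prop, left_ideal K -> ~ K 1 -> (forall a, I a -> K a) ->
     forall a, K a -> I a).

Definition maximal_right_ideal (I : S -> Prop) : Prop :=
  right_ideal I /\ ~ I 1 /\
  (forall K : S -> Prop, right_ideal K -> ~ K 1 -> (forall a, I a -> K a) ->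
     forall a, K a -> I a).

Definition jacobson (a : S) : Prop :=
  forall M : S -> Prop, maximal_left_ideal M -> M a.

Definition left_quasi_duo : Prop :=
  forall M, maximal_left_ideal M -> two_sided_ideal M.

Definition right_quasi_duo : Prop :=
  forall M, maximal_right_ideal M -> two_sided_ideal M.

End Ideals.

(* Main.v *)
Require Import Defs.
From HB Require Import structures.
From mathcomp Require Import all_boot all_order all_algebra.
From mathcomp Require Import boolp classical_sets.
Set Implicit Arguments. Unset Strict Implicit. Unset Printing Implicit Defensive.
Import GRing.Theory.
Local Open Scope ring_scope.

(** If every maximal left ideal is two-sided, then each S/M is a division ring.
    Let w in R lie outside M, and put P = M :&: R, a d-stable completely prime
    ideal.  Comparing leading coefficients in the domain S/P[x; d] = (R/P)[x; d],
    1 - w x generates a proper left ideal there, so some maximal left ideal M'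
    contains P and 1 - w x: modulo M', the element w is a unit with inverse x,
    hence commutes with everything that commutes with x.

    Let D = [y, -] be d (y = x), or, once d(R) is known to lie in J(S), an inner
    derivation of R (y in R); in both cases x y = y x modulo J(S).  If w = D a is
    not in M, inverting w gives M1 with D w in M1 and w, a not in M1; then
    inverting w a gives M2, containing M1 :&: R and D (w a) = w^2 + (D w) a,
    hence w, although w a is a unit modulo M2.  So D a lies in J(S), which proves
    (i) => (v).  The right-handed case is the same argument in the opposite ring,
    and (v) makes S/J(S) commutative, which yields everything else. *)

(** * Left ideals, maximal left ideals and the Jacobson radical *)

Section LeftIdeals.
Variable S : nzRingType.
Implicit Types (I L M : S -> Prop) (a b s t : S).

Lemma left_ideal0 I : left_ideal I -> I 0.
Proof. by case. Qed.

Lemma left_idealB I a b : left_ideal I -> I a -> I b -> I (a - b).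
Proof. by case=> _ [IB _]; exact: IB. Qed.

Lemma left_idealN I a : left_ideal I -> I a -> I (- a).
Proof. by move=> II Ia; rewrite -sub0r; apply: left_idealB => //; apply: left_ideal0. Qed.

Lemma left_idealD I a b : left_ideal I -> I a -> I b -> I (a + b).
Proof. by move=> II Ia Ib; rewrite -[b]opprK; apply: left_idealB => //; apply: left_idealN. Qed.

Lemma left_idealM I s a : left_ideal I -> I a -> I (s * a).
Proof. by case=> _ [_ IM]; exact: IM. Qed.

Lemma right_idealM I s a : right_ideal I -> I a -> I (a * s).
Proof. by case=> _ [_ IM]; exact: IM. Qed.

Lemma left_ideal_sum I (J : Type) (r : seq J) (F : J -> S) :
  left_ideal I -> (forall j, I (F j)) -> I (\sum_(j <- r) F j).
Proof.
move=> II IF; elim/big_ind: _ => //; first exact: left_ideal0.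
by move=> a b; apply: left_idealD.
Qed.

(* Zorn's lemma is applied to the sets A such that A `|` L is an ideal, because
   the union of the empty chain does not contain L. *)
Lemma exists_maximal_left_ideal L : left_ideal L -> ~ L 1 ->
  exists M, maximal_left_ideal M /\ forall a, L a -> M a.
Proof.
move=> LL L1.
pose P (A : set S) := left_ideal (fun a => A a \/ L a) /\ ~ A 1.
have PK K : left_ideal K -> ~ K 1 -> (forall a, L a -> K a) -> P K.
  move=> KK K1 LK; split=> //.
  have eqK a : (K a \/ L a) -> K a by case=> // /LK.
  split; first by right; apply: left_ideal0.
  by split=> [a b /eqK Ka /eqK Kb|s a /eqK Ka]; left;
     [apply: left_idealB | apply: left_idealM].
have [F FP Ftot|A [[AL A1] Amax]] := @Zorn_bigcup S P.
  split; last by move=> [X FX X1]; case: (FP _ FX).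
  split; first by right; apply: left_ideal0.
  split=> [a b|s a].
    case=> [[X FX Xa]|La] [[Y FY Yb]|Lb].
    - have [Z [FZ Za Zb]] : exists Z : set S, [/\ F Z, Z a & Z b].
        by case: (Ftot _ _ FX FY) => [XY|YX]; [exists Y|exists X]; split => //;
          [apply: XY|apply: YX].
      case: (FP _ FZ) => ZL _.
      have [Zab|] := left_idealB ZL (or_introl Za) (or_introl Zb); last by right.
      by left; exists Z.
    - case: (FP _ FX) => XL _.
      have [Xab|] := left_idealB XL (or_introl Xa) (or_intror Lb); last by right.
      by left; exists X.
    - case: (FP _ FY) => YL _.
      have [Yab|] := left_idealB YL (or_intror La) (or_introl Yb); last by right.
      by left; exists Y.
    - by right; apply: left_idealB.
  case=> [[X FX Xa]|La]; last by right; apply: left_idealM.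
  case: (FP _ FX) => XL _.
  have [Xsa|] := left_idealM s XL (or_introl Xa); last by right.
  by left; exists X.
exists (fun a => A a \/ L a); split; last by right.
split=> //; split; first by case.
move=> K KK K1 AK a Ka.
have PKK : P K by apply: PK => // b Lb; apply: AK; right.
left; apply: contrapT => nAa; apply: (Amax K) PKK.
by split=> [b Ab|KA]; [apply: AK; left | apply/nAa/KA].
Qed.

(** Otherwise the left ideal [M] + S a would be proper, so by maximality it would lie in [M],
    although it contains [a]. *)
Lemma maximal_left_inverse M a : maximal_left_ideal M -> ~ M a ->
  exists s, M (1 - s * a).
Proof.
move=> [ML [M1 Mmax]] nMa; apply: contrapT => noinv; apply: nMa.
apply: (Mmax (fun b => exists s, M (b - s * a))).
- split; first by exists 0; rewrite mul0r subrr; apply: left_ideal0.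
  split=> [b c [s Mb] [t Mc]|r b [s Mb]].
    exists (s - t); rewrite mulrBl opprD addrACA -opprD.
    exact: left_idealB.
  by exists (r * s); rewrite -mulrA -mulrBr; apply: left_idealM.
- exact: noinv.
- by move=> b Mb; exists 0; rewrite mul0r subr0.
- by exists 1; rewrite mul1r subrr; apply: left_ideal0.
Qed.

(** Modulo [M] the element [a] has a left inverse, which cancels it from [a * b]; right absorption
    handles [(1 - s * a) * b]. *)
Lemma maximal_left_prime M a b : maximal_left_ideal M -> two_sided_ideal M ->
  M (a * b) -> ~ M a -> M b.
Proof.
move=> Mmax [ML MR] Mab /(maximal_left_inverse Mmax)[s Ms].
have -> : b = (1 - s * a) * b + s * (a * b).
  by rewrite mulrBl mul1r mulrA subrK.
by apply: left_idealD => //; [apply: right_idealM | apply: left_idealM].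
Qed.

Lemma jacobson_left_ideal : left_ideal (@jacobson S).
Proof.
split; first by move=> M [[]].
split=> [a b Ja Jb M MM|s a Ja M MM].
  by apply: left_idealB; [case: MM|apply: Ja|apply: Jb].
by apply: left_idealM; [case: MM|apply: Ja].
Qed.

(** If S (1 - a) were proper, a maximal left ideal above it would contain both 1 - a and a. *)
Lemma jacobson_left_inverse a : jacobson a -> exists t, t * (1 - a) = 1.
Proof.
move=> Ja; apply: contrapT => noinv.
have [||M [MM LM]] := @exists_maximal_left_ideal (fun b => exists t, t * (1 - a) = b).
- split; first by exists 0; rewrite mul0r.
  split=> [_ _ [s <-] [t <-]|r _ [s <-]]; first by exists (s - t); rewrite mulrBl.
  by exists (r * s); rewrite mulrA.
- exact: noinv.
case: (MM) => ML [M1 _]; apply: M1; rewrite -[1](subrK a).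
by apply: left_idealD => //; [apply: LM; exists 1; rewrite mul1r | apply: Ja].
Qed.

(** A left inverse [t] of 1 - a equals 1 + t a, again 1 minus a radical element, so it has a left
    inverse too, necessarily 1 - a. *)
Lemma jacobson_right_inverse a : jacobson a -> exists t, (1 - a) * t = 1.
Proof.
move=> Ja; have [t t_inv] := jacobson_left_inverse Ja.
have tE : 1 - (- (t * a)) = t by rewrite opprK -t_inv mulrBr mulr1 subrK.
have [u] : exists u, u * (1 - (- (t * a))) = 1.
  have JL := jacobson_left_ideal.
  exact: jacobson_left_inverse (left_idealN JL (left_idealM t JL Ja)).
rewrite tE => u_inv; exists t; suff <- : u = 1 - a by [].
by rewrite -[u]mulr1 -{1}t_inv mulrA u_inv mul1r.
Qed.

End LeftIdeals.

(** * Left-right symmetry of the Jacobson radical *)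

Lemma jacobson_maximal_right (S : nzRingType) (a : S) (N : S -> Prop) :
  jacobson a -> maximal_right_ideal N -> N a.
Proof.
move=> Ja Nmax; apply: contrapT => nNa.
have [s Ns] : exists s, N (1 - a * s).
  exact: (@maximal_left_inverse S^c N a Nmax nNa).
have [u u_inv] : exists u, (1 - s * a) * u = 1.
  exact: jacobson_right_inverse (left_idealM s (jacobson_left_ideal S) Ja).
case: Nmax => NR [N1 _]; apply: N1.
(* If [u] is a right inverse of 1 - s a, then 1 + a u s is one of 1 - a s. *)
have <- : (1 - a * s) * (1 + a * u * s) = 1.
  have -> : (1 - a * s) * (1 + a * u * s) = 1 - a * s + a * ((1 - s * a) * u) * s.
    by rewrite mulrDr mulr1; congr (_ + _); rewrite !mulrBl !mul1r mulrBr mulrBl !mulrA.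
  by rewrite u_inv mulr1 subrK.
exact: right_idealM.
Qed.

Lemma jacobson_converse (S : nzRingType) (a : S) :
  @jacobson S^c a <-> jacobson a.
Proof.
split=> Ja M MM; last exact: jacobson_maximal_right.
exact: (@jacobson_maximal_right S^c a M Ja MM).
Qed.

Lemma jacobson_right_ideal (S : nzRingType) : right_ideal (@jacobson S).
Proof.
have [J0 [JB JM]] := jacobson_left_ideal S^c.
split; first exact/jacobson_converse.
split=> [a b /jacobson_converse Ja /jacobson_converse Jb|s a /jacobson_converse Ja];
  apply/jacobson_converse; [exact: JB | exact: JM].
Qed.

(** * Commutators in a left quasi-duo ring *)

Section Commutators.
Variables (S : nzRingType) (A : S -> Prop) (x : S).
Hypothesis AM : forall a b, A a -> A b -> A (a * b).
Hypothesis invert : forall M w, maximal_left_ideal M -> two_sided_ideal M ->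
  A w -> ~ M w -> exists M', [/\ maximal_left_ideal M',
    forall a, A a -> M a -> M' a & M' (1 - w * x)].
Hypothesis Sduo : left_quasi_duo S.

Lemma commutator_in_jacobson y :
  (forall a, A a -> A (y * a - a * y)) -> jacobson (x * y - y * x) ->
  forall a, A a -> jacobson (y * a - a * y).
Proof.
move=> Ay Jxy a Aa M Mmax; apply: contrapT; set w := y * a - a * y => nMw.
have Aw : A w by apply: Ay.
(* Modulo [N] the element [v] has inverse [x], and [y] commutes with [x], hence with [v]: the
   identity below puts (y v - v y) x in [N], and [x] is not in [N]. *)
have unitw N v : maximal_left_ideal N -> N (1 - v * x) ->
    ~ N v /\ N (y * v - v * y).
  move=> Nmax Nv; have [NL NR] := Sduo Nmax; have [_ [N1 _]] := Nmax.
  have notN u : N (v * u) -> N (1 - v * u) -> False.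
    by move=> Nvu Nvu1; apply: N1; rewrite -[1](subrK (v * u)); apply: left_idealD.
  split; first by move=> Nv'; apply: (notN x) => //; apply: right_idealM.
  have [//|] : N (y * v - v * y) \/ ~ N (y * v - v * y) := EM _.
  move=> /(maximal_left_prime Nmax (Sduo Nmax)) Nx.
  case: (notN x) => //; apply: left_idealM => //; apply: Nx.
  have -> : (y * v - v * y) * x =
            v * (x * y - y * x) + (1 - v * x) * y - y * (1 - v * x).
    rewrite !mulrBl !mulrBr mul1r mulr1 !mulrA opprB.
    rewrite [v * x * y - _]addrC [y - v * x * y]addrC [_ + (_ + y)]addrA addrK.
    by rewrite [_ - y]addrC addrA addrK addrC.
  apply: left_idealB => //; last exact: left_idealM.
  apply: left_idealD => //; last exact: right_idealM.
  exact: left_idealM NL (Jxy _ Nmax).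
have [M1 [M1max MM1 M1w]] := invert Mmax (Sduo Mmax) Aw nMw.
have [nM1w M1yw] := unitw _ _ M1max M1w.
have [M1L M1R] := Sduo M1max.
have nM1a : ~ M1 a.
  by move=> M1a; apply: nM1w; apply: left_idealB => //;
     [apply: left_idealM | apply: right_idealM].
have nM1wa : ~ M1 (w * a).
  by move=> /(maximal_left_prime M1max (Sduo M1max)) /(_ nM1w).
have [M2 [M2max MM2 M2wa]] := invert M1max (Sduo M1max) (AM Aw Aa) nM1wa.
have [nM2wa M2ywa] := unitw _ _ M2max M2wa.
have [M2L M2R] := Sduo M2max.
have nM2w : ~ M2 w by move=> M2w; apply: nM2wa; apply: right_idealM.
apply: (nM2w); apply: (maximal_left_prime M2max (Sduo M2max) _ nM2w).
(* This is w D(a) = D(w a) - D(w) a. From [M1] only elements of [A] are known to pass to [M2]; D(w)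
   is such an element. *)
have -> : w * w = (y * (w * a) - w * a * y) - (y * w - w * y) * a.
  have -> : w * w = w * (y * a - a * y) by [].
  by rewrite mulrBr [(_ - w * y) * a]mulrBl !mulrA opprB [RHS]addrC subrKA.
apply: left_idealB => //; apply: right_idealM => //; apply: MM2 => //.
exact: Ay.
Qed.

End Commutators.

(** Used to define the degree of a polynomial modulo an ideal; membership need not be decidable, so
    the induction on the bound is classical. *)
Lemma exists_last_counterexample (P : nat -> Prop) (N : nat) :
  (forall j, (N <= j)%N -> P j) -> ~ (forall j, P j) ->
  exists n, ~ P n /\ forall j, (n < j)%N -> P j.
Proof.
elim: N => [PN|N IHN PN] nP; first by case: nP => j; apply: PN.
have [PNN|nPN] := EM (P N); last by exists N.
by apply: IHN => // j; rewrite leq_eqVlt => /predU1P[<-//|]; apply: PN.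
Qed.

(** * Multiplication in R[x; d] read on left coefficients *)

Section DiffPoly.
Variables (R : nzRingType) (d : {additive R -> R}) (S : nzRingType).
Variables (iota : {rmorphism R -> S}) (x : S).
Hypothesis xiota : forall r : R, x * iota r = iota r * x + iota (d r).

Definition diff_poly (p : {poly R}) : S := \sum_(i < size p) iota p`_i * x ^+ i.

Lemma diff_poly_widen n (p : {poly R}) : (size p <= n)%N ->
  diff_poly p = \sum_(i < n) iota p`_i * x ^+ i.
Proof.
move=> le_pn; rewrite /diff_poly (big_ord_widen n (fun i => iota p`_i * x ^+ i)) //.
rewrite big_mkcond; apply: eq_bigr => i _; case: ltnP => // le_pi.
by rewrite nth_default // rmorph0 mul0r.
Qed.

Lemma diff_polyD p q : diff_poly (p + q) = diff_poly p + diff_poly q.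
Proof.
pose n := maxn (size p) (size q).
rewrite !(@diff_poly_widen n) ?leq_maxl ?leq_maxr ?size_polyD // -big_split.
by apply: eq_bigr => i _; rewrite coefD rmorphD mulrDl.
Qed.

Lemma diff_polyN p : diff_poly (- p) = - diff_poly p.
Proof.
by rewrite /diff_poly size_polyN -sumrN; apply: eq_bigr => i _;
   rewrite coefN rmorphN mulNr.
Qed.

Lemma diff_polyZ r p : diff_poly (r *: p) = iota r * diff_poly p.
Proof.
rewrite (diff_poly_widen (size_scale_leq r p)) mulr_sumr.
by apply: eq_bigr => i _; rewrite coefZ rmorphM mulrA.
Qed.

Lemma diff_polyMX p : diff_poly (p * 'X) = diff_poly p * x.
Proof.
rewrite (@diff_poly_widen (size p).+1).
  rewrite big_ord_recl coefMX eqxx rmorph0 mul0r add0r mulr_suml.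
  by apply: eq_bigr => i _; rewrite coefMX /= -mulrA exprSr.
by rewrite (leq_trans (size_polyMleq _ _)) // size_polyX addn2.
Qed.

Lemma diff_polyC r : diff_poly r%:P = iota r.
Proof.
rewrite (@diff_poly_widen 1) ?size_polyC_leq1 // big_ord1 coefC eqxx.
by rewrite expr0 mulr1.
Qed.

Lemma mulX_diff_poly p : x * diff_poly p = diff_poly (p * 'X + map_poly d p).
Proof.
rewrite diff_polyD diff_polyMX (@diff_poly_widen (size p) (map_poly d p)) ?size_poly //.
rewrite /diff_poly mulr_sumr mulr_suml -big_split; apply: eq_bigr => i _.
by rewrite coef_map /= mulrA xiota mulrDl -!mulrA -exprSr -exprS.
Qed.

Variable coefs : S -> {poly R}.
Hypothesis coefsK : cancel coefs diff_poly.
Hypothesis diff_polyK : cancel diff_poly coefs.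

Lemma coefsD s t : coefs (s + t) = coefs s + coefs t.
Proof. by apply: (can_inj diff_polyK); rewrite diff_polyD !coefsK. Qed.

Lemma coefsN s : coefs (- s) = - coefs s.
Proof. by apply: (can_inj diff_polyK); rewrite diff_polyN !coefsK. Qed.

Lemma coefs_iota r : coefs (iota r) = r%:P.
Proof. by rewrite -diff_polyC diff_polyK. Qed.

Lemma coefs1 : coefs 1 = 1.
Proof. by rewrite -(rmorph1 iota) coefs_iota. Qed.

Lemma coefs0 : coefs 0 = 0.
Proof. by rewrite -(rmorph0 iota) coefs_iota. Qed.

Lemma coefs_iotaM r s : coefs (iota r * s) = r *: coefs s.
Proof. by apply: (can_inj diff_polyK); rewrite diff_polyZ !coefsK. Qed.

Lemma coefsMx s : coefs (s * x) = coefs s * 'X.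
Proof. by apply: (can_inj diff_polyK); rewrite diff_polyMX !coefsK. Qed.

Lemma coefs_xM s : coefs (x * s) = coefs s * 'X + map_poly d (coefs s).
Proof. by apply: (can_inj diff_polyK); rewrite -mulX_diff_poly !coefsK. Qed.

Lemma coef_coefs_xM s i :
  (coefs (x * s))`_i.+1 = (coefs s)`_i + d (coefs s)`_i.+1.
Proof. by rewrite coefs_xM coefD coefMX coef_map. Qed.

(** Moving r past x^n creates only terms of lower degree: with the next lemma, x^n r = r x^n + lower
    terms. *)
Lemma coef_coefs_XnM_gt n r j : (n < j)%N -> (coefs (x ^+ n * iota r))`_j = 0.
Proof.
elim: n j => [|n IHn] [|j] //; first by rewrite mul1r coefs_iota coefC.
move=> ltnj; rewrite exprS -mulrA coef_coefs_xM !IHn ?raddf0 ?addr0 //.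
by rewrite ltnS in ltnj; apply: leq_trans ltnj _.
Qed.

Lemma coef_coefs_XnM n r : (coefs (x ^+ n * iota r))`_n = r.
Proof.
elim: n => [|n IHn]; first by rewrite mul1r coefs_iota coefC.
by rewrite exprS -mulrA coef_coefs_xM IHn coef_coefs_XnM_gt // raddf0 addr0.
Qed.

Lemma coef_coefsM_iota s r j : (coefs (s * iota r))`_j =
  \sum_(i < size (coefs s)) (coefs s)`_i * (coefs (x ^+ i * iota r))`_j.
Proof.
rewrite -{1}[s]coefsK /diff_poly mulr_suml.
rewrite (big_morph coefs coefsD coefs0) coef_sum.
by apply: eq_bigr => i _; rewrite -mulrA coefs_iotaM coefZ.
Qed.

(** S is generated as a ring by the image of R and x, so closure properties need checking only
    there. *)
Lemma diff_poly_ring_ind (T : S -> Prop) :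
  (forall s t, T s -> T t -> T (s + t)) -> (forall s t, T s -> T t -> T (s * t)) ->
  (forall r, T (iota r)) -> T x -> forall s, T s.
Proof.
move=> TD TM Tiota Tx s; rewrite -[s]coefsK.
have T0 : T 0 by rewrite -(rmorph0 iota).
have TX n : T (x ^+ n).
  elim: n => [|n IHn]; first by rewrite expr0 -(rmorph1 iota).
  by rewrite exprS; apply: (TM).
by apply: (big_ind T) => // i _; apply: TM.
Qed.

(** * Inverting an element of R outside a completely prime ideal *)

Section PrimeExtension.
Variable M : S -> Prop.
Hypothesis M2 : two_sided_ideal M.
Hypothesis M1 : ~ M 1.
Hypothesis Mprime : forall a b, M (a * b) -> ~ M a -> M b.

Let ML : left_ideal M. Proof. by case: M2. Qed.
Let MR : right_ideal M. Proof. by case: M2. Qed.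

Lemma ideal_derivation r : M (iota r) -> M (iota (d r)).
Proof.
move=> Mr; have -> : iota (d r) = x * iota r - iota r * x by rewrite xiota addrC addKr.
by apply: left_idealB => //; [apply: left_idealM | apply: right_idealM].
Qed.

(* The ideal (M :&: R)[x; d] of S. *)
Definition coefs_in (s : S) : Prop := forall i, M (iota (coefs s)`_i).

Lemma coefs_inB s t : coefs_in s -> coefs_in t -> coefs_in (s - t).
Proof.
move=> Ms Mt i; rewrite coefsD coefsN coefD coefN rmorphB.
exact: left_idealB.
Qed.

Lemma coefs_in0 : coefs_in 0.
Proof. by move=> i; rewrite coefs0 coef0 rmorph0; apply: left_ideal0. Qed.

Lemma coefs_inD s t : coefs_in s -> coefs_in t -> coefs_in (s + t).
Proof. by move=> Ms Mt i; rewrite coefsD coefD rmorphD; apply: left_idealD. Qed.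

Lemma coefs_in_iota r : M (iota r) -> coefs_in (iota r).
Proof.
move=> Mr i; rewrite coefs_iota coefC; case: ifP => // _.
by rewrite rmorph0; apply: left_ideal0.
Qed.

(** The case of x rests on the stability of M :&: R under [d], since x t has coefficients t_(i-1) +
    d(t_i). *)
Lemma coefs_in_left s t : coefs_in t -> coefs_in (s * t).
Proof.
move: s t; apply: diff_poly_ring_ind => [s s' Is Is' t It|s s' Is Is' t It|r t It i|t It i].
- by rewrite mulrDl; apply: coefs_inD; [apply: Is|apply: Is'].
- by rewrite -mulrA; apply/Is/Is'.
- by rewrite coefs_iotaM coefZ rmorphM; apply: left_idealM.
- rewrite coefs_xM coefD coefMX coef_map rmorphD.
  apply: left_idealD => //; last exact: ideal_derivation.
  by case: i => [|i] /=; rewrite ?rmorph0 //; apply: left_ideal0.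
Qed.

Lemma coefs_in_right s t : coefs_in t -> coefs_in (t * s).
Proof.
move: s t; apply: diff_poly_ring_ind => [s s' Is Is' t It|s s' Is Is' t It|r t It i|t It i].
- by rewrite mulrDr; apply: coefs_inD; [apply: Is|apply: Is'].
- by rewrite mulrA; apply/Is'/Is.
- rewrite coef_coefsM_iota rmorph_sum; apply: left_ideal_sum => // j.
  by rewrite rmorphM; apply: right_idealM.
- rewrite coefsMx coefMX; case: i => [|i] //=.
  by rewrite rmorph0; apply: left_ideal0.
Qed.

(** Either [s] vanishes modulo (M :&: R)[x; d], or it has a degree n there. *)
Lemma coefs_in_or_last s : coefs_in s \/ exists n, ~ M (iota (coefs s)`_n) /\
  forall j, (n < j)%N -> M (iota (coefs s)`_j).
Proof.
have [|] := EM (coefs_in s); [by left|right].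
apply: (@exists_last_counterexample _ (size (coefs s))) => // j lej.
by rewrite nth_default // rmorph0; apply: left_ideal0.
Qed.

Variable w : R.
Hypothesis nMw : ~ M (iota w).

(** If [s] has degree n modulo [M], the coefficient of s (1 - w x) in degree n + 1 is - s_n w,
    nonzero modulo [M] by primeness. If [s] vanishes there, the constant coefficient gives 1 in
    [M]. *)
Lemma leftmul_one_sub_proper s : ~ coefs_in (1 - s * (1 - iota w * x)).
Proof.
have cE i : (coefs (1 - s * (1 - iota w * x)))`_i =
    (1 : {poly R})`_i - ((coefs s)`_i - (coefs (s * iota w * x))`_i).
  by rewrite mulrBr mulr1 mulrA !(coefsD, coefsN, coefs1) !(coefD, coefN).
case: (coefs_in_or_last s) => [Is|[n [nMn Mgt]]] I1.
  move/(_ 0%N): I1; rewrite cE coefsMx coefMX subr0 coefC rmorphB rmorph1 => M1s.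
  apply: M1; rewrite -[1](subrK (iota (coefs s)`_0)).
  by apply: left_idealD => //; apply: Is.
move/(_ n.+1): I1; rewrite cE coefsMx coefMX coefC /= sub0r opprB.
rewrite rmorphB => Mdiff.
have {Mdiff} : M (iota (coefs (s * iota w))`_n).
  rewrite -[iota _](subrK (iota (coefs s)`_n.+1)).
  by apply: left_idealD => //; apply: Mgt.
have lt_n : (n < size (coefs s))%N.
  rewrite ltnNge; apply/negP => le_n; apply: nMn.
  by rewrite nth_default // rmorph0; apply: left_ideal0.
(* In the n-th coefficient of s w, the terms s_i (x^i w)_n vanish for i < n and lie in [M] for i >
   n, which leaves s_n w. *)
rewrite coef_coefsM_iota (bigD1 (Ordinal lt_n)) //= coef_coefs_XnM.
set rest := (X in _ + X); rewrite rmorphD => Msum.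
have Mrest : M (iota rest).
  rewrite rmorph_sum; elim/big_ind: _ => [|a b Ma Mb|i /negP ni].
  - exact: left_ideal0.
  - exact: left_idealD.
  - rewrite rmorphM; case: (ltngtP i n) => [lt_in|lt_ni|eq_in].
    + by rewrite coef_coefs_XnM_gt // rmorph0 mulr0; apply: left_ideal0.
    + by apply: right_idealM => //; apply: Mgt.
    + by case: ni; apply/eqP/val_inj.
have : M (iota (coefs s)`_n * iota w).
  by rewrite -rmorphM -[iota _](addrK (iota rest)); apply: left_idealB.
by move/Mprime/(_ nMn).
Qed.

(** The product x w is w x read in the opposite ring. In degree n + 1 the coefficient of (1 - x w) s
    is - w s_n modulo [M], because the extra term d(w s_(n+1)) lies in [M]. *)
Lemma rightmul_one_sub_proper s : ~ coefs_in (1 - (1 - x * iota w) * s).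
Proof.
have cE i : (coefs (1 - (1 - x * iota w) * s))`_i =
    (1 : {poly R})`_i - ((coefs s)`_i - (coefs (x * (iota w * s)))`_i).
  by rewrite mulrBl mul1r -mulrA !(coefsD, coefsN, coefs1) !(coefD, coefN).
case: (coefs_in_or_last s) => [Is|[n [nMn Mgt]]] I1.
  move/(_ 0%N): I1; rewrite cE rmorphB coefC rmorph1 => M1s.
  apply: M1; rewrite -[1](subrK (iota ((coefs s)`_0 - (coefs (x * (iota w * s)))`_0))).
  apply: left_idealD => //; rewrite rmorphB; apply: left_idealB => //.
  by apply: coefs_in_left; apply: coefs_in_left.
move/(_ n.+1): I1; rewrite cE coef_coefs_xM !coefs_iotaM !coefZ coefC /= sub0r opprB.
rewrite !(rmorphB, rmorphD) => Mdiff.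
have Mn1 : M (iota (coefs s)`_n.+1) by apply: Mgt.
have Md : M (iota (d (w * (coefs s)`_n.+1))).
  by apply: ideal_derivation; rewrite rmorphM; apply: left_idealM.
have : M (iota w * iota (coefs s)`_n).
  rewrite -rmorphM -[iota _](addrK (iota (d (w * (coefs s)`_n.+1)))).
  apply: left_idealB => //; rewrite -[X in M X](subrK (iota (coefs s)`_n.+1)).
  exact: left_idealD.
by move/Mprime/(_ nMw).
Qed.

Lemma exists_left_inverting : exists M', [/\ maximal_left_ideal M',
  forall r, M (iota r) -> M' (iota r) & M' (1 - iota w * x)].
Proof.
(* This is the left ideal (M :&: R)[x; d] + S (1 - w x). *)
pose L t := exists s, coefs_in (t - s * (1 - iota w * x)).
have LL : left_ideal L.
  split; first by exists 0; rewrite mul0r subr0; apply: coefs_in0.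
  split=> [a b [s Ia] [t Ib]|r a [s Ia]].
    by exists (s - t); rewrite mulrBl opprD addrACA -opprD; apply: coefs_inB.
  by exists (r * s); rewrite -mulrA -mulrBr; apply: coefs_in_left.
have [|M' [M'max LM']] := @exists_maximal_left_ideal S L LL.
  by move=> [s]; apply: leftmul_one_sub_proper.
exists M'; split=> // [r Mr|]; apply: LM'.
  by exists 0; rewrite mul0r subr0; apply: coefs_in_iota.
by exists 1; rewrite mul1r subrr; apply: coefs_in0.
Qed.

Lemma exists_right_inverting : exists M', [/\ maximal_right_ideal M',
  forall r, M (iota r) -> M' (iota r) & M' (1 - x * iota w)].
Proof.
pose L t := exists s, coefs_in (t - (1 - x * iota w) * s).
have LL : right_ideal L.
  split; first by exists 0; rewrite mulr0 subr0; apply: coefs_in0.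
  split=> [a b [s Ia] [t Ib]|r a [s Ia]].
    by exists (s - t); rewrite mulrBr opprD addrACA -opprD; apply: coefs_inB.
  by exists (s * r); rewrite mulrA -mulrBl; apply: coefs_in_right.
have [|M' [M'max LM']] := @exists_maximal_left_ideal S^c L LL.
  by move=> [s]; apply: rightmul_one_sub_proper.
exists M'; split=> // [r Mr|]; apply: LM'.
  by exists 0; rewrite mulr0 subr0; apply: coefs_in_iota.
by exists 1; rewrite mulr1 subrr; apply: coefs_in0.
Qed.

End PrimeExtension.

(** * From either quasi-duo condition to (v) *)

Lemma left_quasi_duo_commutators : left_quasi_duo S ->
  (forall a b : R, jacobson (iota (a * b - b * a))) /\ (forall r, jacobson (iota (d r))).
Proof.
move=> Sduo; pose A s := exists r, s = iota r.
have AM a b : A a -> A b -> A (a * b).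
  by move=> [r ->] [t ->]; exists (r * t); rewrite rmorphM.
have invert M w : maximal_left_ideal M -> two_sided_ideal M ->
  A w -> ~ M w -> exists M', [/\ maximal_left_ideal M',
    forall a, A a -> M a -> M' a & M' (1 - w * x)].
  move=> Mmax M2 [r ->] nMr; case: (Mmax) => _ [M1 _].
  have Mprime a b := @maximal_left_prime _ _ a b Mmax M2.
  have [M' [M'max MM' M'w]] := exists_left_inverting M2 M1 Mprime nMr.
  by exists M'; split=> // _ [t ->]; apply: MM'.
have commE := commutator_in_jacobson AM invert Sduo.
have Jd r : jacobson (iota (d r)).
  have xE t : x * iota t - iota t * x = iota (d t) by rewrite xiota addrC addKr.
  rewrite -xE; apply: (commE x _ _ (iota r)); last by exists r.
    by move=> _ [t ->]; exists (d t).
  by rewrite subrr; exact: left_ideal0 (jacobson_left_ideal S).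
split=> // a b; rewrite rmorphB !rmorphM.
apply: (commE (iota a) _ _ (iota b)); last by exists b.
  by move=> _ [t ->]; exists (a * t - t * a); rewrite rmorphB !rmorphM.
(* What remains is that x commutes with a modulo J(S); the commutator is d(a), covered by [Jd]. *)
by rewrite xiota addrC addKr.
Qed.

Lemma right_quasi_duo_commutators : right_quasi_duo S ->
  (forall a b : R, jacobson (iota (a * b - b * a))) /\ (forall r, jacobson (iota (d r))).
Proof.
move=> Sduo; pose A (s : S^c) := exists r, s = iota r.
have Sduo' : left_quasi_duo S^c by move=> M /Sduo[].
have AM a b : A a -> A b -> A (a * b).
  by move=> [r ->] [t ->]; exists (t * r); rewrite rmorphM.
have invert M w : @maximal_left_ideal S^c M -> @two_sided_ideal S^c M ->
  A w -> ~ M w -> exists M', [/\ @maximal_left_ideal S^c M',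
    forall a, A a -> M a -> M' a & M' (1 - w * (x : S^c))].
  move=> Mmax M2 [r ->] nMr; case: (Mmax) => _ [M1 _].
  have M2' : @two_sided_ideal S M by case: M2.
  (* Primeness obtained in [S^c] cancels the right-hand factor of a product of S; contraposition
     moves this to the left-hand factor. *)
  have Mprime (a b : S) : M (a * b) -> ~ M a -> M b.
    move=> Mab nMa; apply: contrapT => nMb; apply: nMa.
    exact: (@maximal_left_prime S^c M b a Mmax M2 Mab nMb).
  have [M' [M'max MM' M'w]] := exists_right_inverting M2' M1 Mprime nMr.
  by exists M'; split=> // _ [t ->]; apply: MM'.
have commE := commutator_in_jacobson AM invert Sduo'.
have Jd r : jacobson (iota (d r)).
  (* In the opposite ring the commutator with x is - d. *)
  have xE t : iota t * x - x * iota t = iota (- d t).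
    by rewrite xiota opprD addrA subrr sub0r rmorphN.
  rewrite -[d r]opprK rmorphN -xE; apply: (left_idealN (jacobson_left_ideal S)).
  apply/jacobson_converse; apply: (commE x _ _ (iota r)); last by exists r.
    by move=> _ [t ->]; exists (- d t); apply: xE.
  by rewrite subrr; exact: left_ideal0 (jacobson_left_ideal S^c).
split=> // a b; rewrite rmorphB !rmorphM.
(* The roles of a and b are exchanged because products are reversed in [S^c]. *)
apply/jacobson_converse; apply: (commE (iota b) _ _ (iota a)); last by exists a.
  by move=> _ [t ->]; exists (t * b - b * t); rewrite rmorphB !rmorphM.
apply/jacobson_converse.
have -> : (x : S^c) * iota b - (iota b : S^c) * x = iota b * x - x * iota b by [].
rewrite xiota opprD addrA subrr sub0r.
exact: left_idealN (jacobson_left_ideal S) (Jd b).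
Qed.

(** * From (v) to commutativity modulo J(S), and its consequences for ideals *)

Lemma commutative_mod_jacobson :
  (forall a b : R, jacobson (iota (a * b - b * a))) -> (forall r, jacobson (iota (d r))) ->
  forall s t : S, jacobson (s * t - t * s).
Proof.
move=> Jcomm Jd; pose J := @jacobson S.
have JL : left_ideal J := jacobson_left_ideal S.
have JR : right_ideal J := jacobson_right_ideal S.
have JC s t : J (s * t - t * s) -> J (t * s - s * t).
  by move=> /(left_idealN JL); rewrite opprB.
(* The elements commuting with [t] modulo J(S) form a subring. This is applied to t = x, then to t
   in R, then to any [t]. *)
have gen t : J (x * t - t * x) -> (forall r, J (iota r * t - t * iota r)) ->
    forall s, J (s * t - t * s).
  move=> Jx Jr; apply: diff_poly_ring_ind => // s s' Js Js'.
    by rewrite mulrDl mulrDr opprD addrACA; apply: (left_idealD JL).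
  have -> : s * s' * t - t * (s * s') = s * (s' * t - t * s') + (s * t - t * s) * s'.
    by rewrite mulrBr mulrBl !mulrA subrKA.
  exact: (left_idealD JL (left_idealM s JL Js') (right_idealM s' JR Js)).
have Jxr r : J (x * iota r - iota r * x) by rewrite xiota addrC addKr; apply: Jd.
have Jx s : J (s * x - x * s).
  apply: gen => [|r]; last exact: JC.
  by rewrite subrr; exact: left_ideal0 JL.
have Jr r s : J (s * iota r - iota r * s).
  by apply: gen => // r'; rewrite -!rmorphM -rmorphB; apply: Jcomm.
by move=> s t; apply: gen => [|r]; apply: JC.
Qed.

End DiffPoly.

Lemma left_ideal_two_sided (S : nzRingType) (L : S -> Prop) :
  (forall s t : S, jacobson (s * t - t * s)) ->
  left_ideal L -> (forall a, jacobson a -> L a) -> two_sided_ideal L.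
Proof.
move=> Jcomm LL JL; split=> //; case: (LL) => L0 [LB _].
(* Here a r differs from r a by a commutator, which lies in J(S) and so in [L]. *)
split=> //; split=> // r a La; rewrite -[a * r](subrK (r * a)).
exact: (left_idealD LL (JL _ (Jcomm _ _)) (left_idealM _ LL La)).
Qed.

Lemma right_ideal_two_sided (S : nzRingType) (L : S -> Prop) :
  (forall s t : S, jacobson (s * t - t * s)) ->
  right_ideal L -> (forall a, jacobson a -> L a) -> two_sided_ideal L.
Proof.
move=> Jcomm LR JL.
have [] : @two_sided_ideal S^c L; last by [].
apply: left_ideal_two_sided => // [s t|a /jacobson_converse]; last exact: JL.
by apply/jacobson_converse; exact: (Jcomm t s).
Qed.

(** As [jacobson (iota r)] means that r lies in J_0, the last assertion states (v) on elements,
    without forming the quotient R/J_0. *)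
Theorem theorem1p1 (R : nzRingType) (d : {additive R -> R})
    (S : nzRingType) (iota : {rmorphism R -> S}) (x : S) :
  is_derivation d -> is_diff_poly_ring d iota x ->
  [<-> left_quasi_duo S;
       right_quasi_duo S;
       (forall L : S -> Prop, left_ideal L -> (forall a, jacobson a -> L a) ->
          two_sided_ideal L);
       (forall L : S -> Prop, right_ideal L -> (forall a, jacobson a -> L a) ->
          two_sided_ideal L);
       (forall a b : R, jacobson (iota (a * b - b * a))) /\
       (forall r : R, jacobson (iota (d r)))].
Proof.
move=> _ [xiota [coefs diff_polyK coefsK]].
have v_comm := commutative_mod_jacobson xiota coefsK.
have i_v := left_quasi_duo_commutators xiota coefsK diff_polyK.
have ii_v := right_quasi_duo_commutators xiota coefsK diff_polyK.
have iii_i : (forall L : S -> Prop, left_ideal L ->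
    (forall a, jacobson a -> L a) -> two_sided_ideal L) -> left_quasi_duo S.
  by move=> iii M Mmax; apply: iii; [case: Mmax | move=> a; apply].
have iv_ii : (forall L : S -> Prop, right_ideal L ->
    (forall a, jacobson a -> L a) -> two_sided_ideal L) -> right_quasi_duo S.
  move=> iv M Mmax; apply: iv; first by case: Mmax.
  (* The radical is defined by maximal left ideals, so the symmetry result is needed here. *)
  by move=> a Ja; apply: jacobson_maximal_right.
(* The goals follow the cycle (i), (ii), (iii), (iv), (v), (i); the first three go through (v) and
   commutativity modulo J(S). *)
tfae.
- move=> /i_v[/v_comm/[apply] comm]; apply: iv_ii => L.
  exact: right_ideal_two_sided.
- by move=> /ii_v[/v_comm/[apply] comm] L; apply: left_ideal_two_sided.
- by move=> /iii_i/i_v[/v_comm/[apply] comm] L; apply: right_ideal_two_sided.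
- by move=> /iv_ii/ii_v.
- move=> [/v_comm/[apply] comm]; apply: iii_i => L.
  exact: left_ideal_two_sided.
Qed.
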